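(* Let $m\in\mathbb{N}$ be arbitrary, and let $k\ge 0$ and $0\le q<2^k$ be the integers such that $m=2^k+q$. Then the number $p(m)$ of $m$-words in the period-doubling sequence $\omega$ is given by $$p(m)=\begin{cases}2 & \text{if } k=0;\\ 3\cdot 2^{k-1}+2q & \text{if } k\ge 1 \text{ and } q\le 2^{k-1};\\ 4\cdot 2^{k-1}+q & \text{if } k\ge 1\text{ and } q>2^{k-1}.\end{cases}$$ Furthermore, for $m=2^k\ge 2$, the set $\mathcal{L}_m(\omega)$ of all $m$-words in $\omega$ is $$\mathcal{L}_m(\omega)=\left\{w_i^{(m)} : 1\le i\le \tfrac{3}{2}m\right\}.$$
   Context: $\mathbb{N}=\{1,2,\dots\}$. The period-doubling sequence $\omega=\omega_1\omega_2\ldots=0100\,0101\,0100\,0100\ldots$ is the unique fixed point in $\{0,1\}^{\mathbb{N}}$ of the substitution $\zeta$ given by $0\mapsto 01$, $1\mapsto 00$; equivalently, $\omega_i = k_i \bmod 2$, where $k_i$ is the largest integer such that $2^{k_i}$ divides $i$. For integers $m,i\ge 1$, $w_i^{(m)}=\omega_i\omega_{i+1}\ldots\omega_{i+m-1}$. The $m$-words in $\omega$ (the allowed $m$-words) are the words of length $m$ that occur as subwords (blocks of consecutive letters) of $\omega$, i.e. the words $w_i^{(m)}$, $i\ge1$. *)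

(* Defs.v *)
From mathcomp Require Import all_boot.
From mathcomp Require Import boolp.

Set Implicit Arguments.
Unset Strict Implicit.
Unset Printing Implicit Defensive.

(* The letters 0, 1 are [false], [true].  A sequence in {0,1}^N with
   N = {1, 2, ...} is a function [x : nat -> bool] whose value at index 0 is
   irrelevant. *)

Definition zeta (a : bool) : seq bool :=
  if a then [:: false; false] else [:: false; true].

(* The concatenation zeta(x_1) zeta(x_2) ...: as zeta has constant length 2,
   its i-th letter (i >= 1) lies in the block zeta(x_j) with
   j = (i - 1) %/ 2 + 1, at 0-based offset (i - 1) %% 2. *)
Definition zeta_seq (x : nat -> bool) (i : nat) : bool :=
  nth false (zeta (x (i.-1 %/ 2).+1)) (i.-1 %% 2).

Definition zeta_fixed (x : nat -> bool) : Prop :=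
  forall i, 1 <= i -> zeta_seq x i = x i.

(* The period-doubling sequence, in its 2-adic description; the two lemmas
   below identify it as the unique fixed point of zeta. *)
Definition omega (i : nat) : bool := odd (logn 2 i).

Lemma zeta_seq_odd x j : zeta_seq x j.*2.+1 = false.
Proof. by rewrite /zeta_seq /= -muln2 modnMl; case: (x _). Qed.

Lemma zeta_seq_even x j : zeta_seq x j.+1.*2 = ~~ x j.+1.
Proof.
rewrite /zeta_seq doubleS /= divn2 modn2 /= uphalf_double odd_double /=.
by case: (x _).
Qed.

Lemma omega_fixed : zeta_fixed omega.
Proof.
case=> // i _; rewrite -(odd_double_half i); case: (odd i) => /=.
  by rewrite add1n -doubleS zeta_seq_even /omega -mul2n lognM //.
rewrite add0n zeta_seq_odd /omega lognE dvdn2 /= odd_double.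
by [].
Qed.

Lemma zeta_fixed_unique x :
  zeta_fixed x -> forall i, 1 <= i -> x i = omega i.
Proof.
move=> fx; elim/ltn_ind=> -[//|i] IH _.
rewrite -fx // -omega_fixed //; move: IH.
rewrite -(odd_double_half i); case: (odd i) => /=.
  rewrite add1n -doubleS !zeta_seq_even => -> //.
  by rewrite doubleS !ltnS -addnn leq_addr.
by rewrite add0n !zeta_seq_odd.
Qed.

Definition word (m i : nat) : m.-tuple bool := [tuple omega (i + j) | j < m].

Definition language (m : nat) : {set m.-tuple bool} :=
  [set u | `[< exists2 i, 1 <= i & u = word m i >]].

Definition complexity (m : nat) : nat := #|language m|.

(* Main.v *)
Require Import Defs.
From mathcomp Require Import all_boot.
From mathcomp Require Import boolp.
From mathcomp Require Import zify.

Set Implicit Arguments.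
Unset Strict Implicit.
Unset Printing Implicit Defensive.

(** Since [omega] is fixed by the substitution, its letters at odd positions
    are 0 and its letter at position [2 t] is the negation of the letter at
    position [t].  A word of length [M] read at position [2 t - c], with [c] a
    bit, is therefore the image of a word read at position [t], of length about
    [M / 2], under an injective map [spread c M] that negates letters and
    alternates them with zeros ([word_spread], [spread_inj]).  Thus the
    [M]-words are the union of two injective images, one of the
    [floor (M / 2)]-words and one of the [ceil (M / 2)]-words.

    A common element of the two images would be the zero word, and for [M >= 3]
    this would require two adjacent ones in [omega], which never occur.  Hence
      p(M) = p(floor (M / 2)) + p(ceil (M / 2))    for M >= 3
    ([complexity_half]).  From [p(1) = 2] and [p(2) = 3] this recursion
    determines [p].  For [m = 2^(k+1) + q] with [0 <= q < 2^(k+1)] the two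
    formulas to be proved for [p(m)] combine into
      p(m) = min (3 * 2^k + 2 q, 4 * 2^k + q),
    a function of [q] whose only change of slope is at [q = 2^k], and this form
    follows by induction on [k] ([complexity_pow2]).

    The same description of words locates them: if every [m]-word starts at
    some position up to [B], then every [2 m]-word starts at some position up to
    [2 B] ([covers_double]).  As the three 2-words start at the positions
    1, 2 and 3, every word of length [2^(k+1)] starts at a position up to
    [3 * 2^k] ([covers_pow2]). *)

Lemma wordP m i s :
  reflect (forall j, j < m -> omega (i + j) = omega (s + j))
          (word m i == word m s).
Proof.
apply: (iffP eqP) => [e j lt_jm|e]; last first.
  by apply: eq_from_tnth => j; rewrite !tnth_mktuple e.
by move/(congr1 (fun u => tnth u (Ordinal lt_jm))): e; rewrite !tnth_mktuple.
Qed.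

Lemma languageP m (u : m.-tuple bool) :
  reflect (exists2 i, 0 < i & u = word m i) (u \in language m).
Proof. by rewrite inE; apply: asboolP. Qed.

Lemma mem_language m i : 0 < i -> word m i \in language m.
Proof. by move=> i_gt0; apply/languageP; exists i. Qed.

Lemma omega_odd i : omega i.*2.+1 = false.
Proof. by rewrite -omega_fixed // zeta_seq_odd. Qed.

Lemma omega_double i : 0 < i -> omega i.*2 = ~~ omega i.
Proof. by case: i => // i _; rewrite -omega_fixed // zeta_seq_even. Qed.

(** One of two adjacent positions is odd, and odd positions carry a 0. *)
Lemma no_two_ones i : 0 < i -> ~~ (omega i && omega i.+1).
Proof.
move=> i_gt0; rewrite -(odd_double_half i); case: (odd i).
  by rewrite add1n omega_odd.
by rewrite add0n omega_odd andbF.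
Qed.

(** The number of even positions among [2 t - c, ..., 2 t - c + M - 1], when
    [t >= 1]. *)
Definition half_length (c : bool) M := if c then M./2 else uphalf M.

Lemma ltn_half_length (c : bool) M h : (h < half_length c M) = (h.*2 + c < M).
Proof. by rewrite /half_length; case: c; lia. Qed.

(** The even positions of a word read at [2 t - c] are at the offsets [j] of the
    parity of [c]; the half of such a position is [t + j./2]. *)
Definition spread (c : bool) M (u : (half_length c M).-tuple bool) :
    M.-tuple bool :=
  [tuple (odd j == c) && ~~ nth false u j./2 | j < M].
Arguments spread : clear implicits.

Lemma tnth_spread_word c M t (j : 'I_M) :
  tnth (spread c M (word (half_length c M) t)) j
  = (odd j == c) && ~~ omega (t + j./2).
Proof.
rewrite tnth_mktuple; case: eqP => // e; congr (~~ _).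
have lt_j : j./2 < half_length c M.
  by rewrite ltn_half_length; have := ltn_ord j; lia.
by rewrite -(tnth_nth false _ (Ordinal lt_j)) tnth_mktuple.
Qed.

Lemma word_spread (c : bool) M t : 0 < t ->
  word M (t.*2 - c) = spread c M (word (half_length c M) t).
Proof.
move=> t_gt0; apply: eq_from_tnth => j.
rewrite tnth_spread_word tnth_mktuple; case: eqP => [e|/eqP ne] /=.
  by rewrite -omega_double ?addn_gt0 ?t_gt0 //; congr omega; lia.
have -> : t.*2 - c + j = ((t.*2 - c + j)./2).*2.+1 by case: c ne => /=; lia.
exact: omega_odd.
Qed.

Lemma doubleB_ex i : 0 < i -> exists c : bool, exists2 t, 0 < t & i = t.*2 - c.
Proof. by move=> i_gt0; exists (odd i); exists (uphalf i); lia. Qed.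

Lemma language_spread M :
  language M = [set spread true M u | u in language (half_length true M)]
           :|: [set spread false M u | u in language (half_length false M)].
Proof.
apply/setP => u; rewrite in_setU; apply/languageP/orP.
  case=> i /doubleB_ex[c [t t_gt0 ->]] ->; rewrite word_spread //.
  by case: c; [left|right]; apply: imset_f; apply: mem_language.
by case=> /imsetP[_ /languageP[t t_gt0 ->] ->];
  [exists (t.*2 - true) | exists (t.*2 - false)];
  rewrite ?word_spread //=; lia.
Qed.

Lemma spread_inj c M : injective (spread c M).
Proof.
move=> u v e; apply: eq_from_tnth => h.
have lt_j : h.*2 + c < M by rewrite -ltn_half_length.
move/(congr1 (fun w => tnth w (Ordinal lt_j))): e.
have parity : odd (h.*2 + c) = c by lia.
have half : (h.*2 + c)./2 = h by lia.
by rewrite !tnth_mktuple /= parity half eqxx -!tnth_nth => /negb_inj.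
Qed.

(** A word in both images has only zeros.  In the second image, the offsets 0
    and 2, which exist because [2 < M], are zeros produced by negating two
    adjacent letters of [omega], so these letters would be two ones. *)
Lemma disjoint_spread M : 2 < M ->
  [disjoint [set spread true M u | u in language (half_length true M)]
          & [set spread false M u | u in language (half_length false M)]].
Proof.
move=> M_gt2; rewrite -setI_eq0; apply/eqP/setP => v; rewrite !inE.
apply/negP => /andP[/imsetP[_ /languageP[s _ ->] ->]].
case/imsetP=> _ /languageP[t t_gt0 ->] e.
(* The letter at an even offset is forced to 0 by the first image. *)
have zero j (lt_jM : j < M) : ~~ odd j -> omega (t + j./2).
  move=> even_j; move/(congr1 (fun w => tnth w (Ordinal lt_jM))): e.
  rewrite (@tnth_spread_word true) (@tnth_spread_word false) /=.
  by rewrite (negbTE even_j) /= => /esym/negbFE.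
have := no_two_ones t_gt0.
have := zero 0 (ltnW (ltnW M_gt2)) isT; have := zero 2 M_gt2 isT.
by rewrite addn0 addn1 => -> ->.
Qed.

Lemma complexity_half M : 2 < M ->
  complexity M = complexity M./2 + complexity (uphalf M).
Proof.
move=> M_gt2; rewrite {1}/complexity language_spread.
rewrite cardsU disjoint_setI0 ?disjoint_spread // cards0 subn0.
by rewrite (card_imset _ (@spread_inj true M))
           (card_imset _ (@spread_inj false M)).
Qed.

Definition covers m B :=
  forall i, 0 < i -> exists2 s, 0 < s <= B & word m i = word m s.

(** A word of length [2 m] read at [2 t - c] depends only on [c] and on the
    [m]-word read at [t], so replacing [t] by some [s <= B] moves it to the
    position [2 s - c <= 2 B]. *)
Lemma covers_double m B : covers m B -> covers m.*2 B.*2.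
Proof.
move=> cov i /doubleB_ex[c [t t_gt0 ->]].
have [s /andP[s_gt0 le_sB] e] := cov t t_gt0.
exists (s.*2 - c); first by lia.
rewrite !word_spread //; congr spread.
by have -> : half_length c m.*2 = m by rewrite /half_length; case: (c); lia.
Qed.

Lemma covers2 : covers 2 3.
Proof.
move=> i i_gt0; have := no_two_ones i_gt0.
case e0: (omega i); case e1: (omega i.+1) => // _;
  [exists 2 | exists 1 | exists 3] => //;
  by apply/eqP/wordP => -[|[|//]] _; rewrite ?addn0 ?addn1 ?e0 ?e1.
Qed.

(** Starting the doubling from words of length 2 gives the constant 3/2; from
    length 1, where two positions are needed, it would only give 2. *)
Lemma covers_pow2 k : covers (2 ^ k.+1) (3 * 2 ^ k).
Proof.
elim: k => [|k IH]; first exact: covers2.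
have := covers_double IH.
by rewrite -!mul2n -expnS mulnCA -expnS.
Qed.

Lemma language_covers m B : covers m B ->
  language m = [set word m (val s).+1 | s in 'I_B].
Proof.
move=> cov; apply/setP => u; apply/languageP/imsetP; last first.
  by case=> s _ ->; exists s.+1.
case=> i /cov[[|s] //= le_sB ->] ->.
by exists (Ordinal le_sB).
Qed.

Lemma complexity_covers m B : covers m B ->
  {in [pred s | 0 < s <= B] &, injective (word m)} -> complexity m = B.
Proof.
move=> cov inj; rewrite /complexity (language_covers cov).
rewrite card_imset ?card_ord //.
move=> s t e; apply: val_inj; apply: succn_inj.
by apply: inj e; rewrite inE ltn_ord.
Qed.

Lemma covers1 : covers 1 2.
Proof.
move=> i _; case e0: (omega i); [exists 2 | exists 1] => //;
  by apply/eqP/wordP => -[|//] _; rewrite addn0 e0.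
Qed.

Lemma complexity1 : complexity 1 = 2.
Proof.
apply: (complexity_covers covers1).
by move=> [|[|[|//]]] [|[|[|//]]] // _ _ /eqP/wordP/(_ 0 isT).
Qed.

Lemma complexity2 : complexity 2 = 3.
Proof.
apply: (complexity_covers covers2).
move=> [|[|[|[|//]]]] [|[|[|[|//]]]] // _ _ /eqP/wordP e;
  by move: (e 0 isT) (e 1 isT).
Qed.

(** The range of [q] includes [2 ^ k.+1] so that the induction closes: halving
    an odd [q] upwards may reach this end point, where the formula agrees with
    the one for the next [k] and [q = 0].  The minimum is affine on both sides
    of the integer [2 ^ k], and two integers differing by at most 1 lie on a
    common side, hence the values at the two halves of [q] add up to the value
    that the formula for [k.+1] takes at [q]. *)
Lemma complexity_pow2 k q : q <= 2 ^ k.+1 ->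
  complexity (2 ^ k.+1 + q) = minn (3 * 2 ^ k + 2 * q) (4 * 2 ^ k + q).
Proof.
elim: k q => [|k IH] q le_q.
  have c3 : complexity 3 = 5.
    by rewrite complexity_half // complexity1 complexity2.
  case: q le_q => [|[|[|//]]] _; first exact: complexity2; first exact: c3.
  by rewrite complexity_half //= complexity2.
rewrite complexity_half; last by rewrite !expnS; have := expn_gt0 2 k; lia.
have -> : (2 ^ k.+2 + q)./2 = 2 ^ k.+1 + q./2 by rewrite (expnS 2 k.+1); lia.
have -> : uphalf (2 ^ k.+2 + q) = 2 ^ k.+1 + uphalf q.
  by rewrite (expnS 2 k.+1); lia.
by rewrite !IH; move: le_q; rewrite !expnS; lia.
Qed.

Theorem theorem1p1 :
  (forall m k q : nat, m = 2 ^ k + q -> q < 2 ^ k ->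
     complexity m =
       if k == 0 then 2
       else if q <= 2 ^ (k - 1) then 3 * 2 ^ (k - 1) + 2 * q
       else 4 * 2 ^ (k - 1) + q)
  /\
  (forall m k : nat, m = 2 ^ k -> 2 <= m ->
     language m =
       [set u | `[< exists2 i, 1 <= i <= (3 * m) %/ 2 & u = word m i >]]).
Proof.
split=> [m k q -> | m [|k] -> // _].
  case: k => [|k] lt_q /=; first by case: q lt_q => // _; apply: complexity1.
  rewrite complexity_pow2 ?(ltnW lt_q) // subn1 /=.
  by case: leqP; lia.
have -> : (3 * 2 ^ k.+1) %/ 2 = 3 * 2 ^ k by rewrite expnS mulnCA mulKn.
apply/setP => u; rewrite [in RHS]inE; apply/idP/asboolP => [/languageP|].
  by case=> i /(@covers_pow2 k)[s s_bd ->] ->; exists s.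
by case=> i /andP[i_gt0 _] ->; apply: mem_language.
Qed.
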